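(* Let $(M^d,\boldsymbol{c},I)$, $d\ge3$, be an almost pseudo-Riemannian structure with scale tractor $I=\frac1dD\sigma$ and scale singularity set $\Sigma:=\mathcal{Z}(\sigma)\neq\emptyset$ that is asymptotically Einstein in the sense that $I^2|_\Sigma=\pm1$ (one fixed sign) and $\nabla_aI_B=\sigma f_{aB}$ for some smooth weight $-1$ tractor-valued $1$-form $f_{aB}$, where $\nabla$ is the tractor connection. Then $\Sigma$ is a totally umbilic hypersurface.
   Context: All objects are smooth. A conformal manifold $(M^d,\boldsymbol{c})$, $d\ge 3$, is a $d$-manifold with a conformal class $\boldsymbol{c}$ of metrics of fixed signature ($\widehat g=\Omega^2g$, $\Omega>0$). $\mathcal{E}[w]$ is the bundle of conformal densities of weight $w$ (a section is a family of functions $(f^g)_{g\in\boldsymbol{c}}$ with $f^{\Omega^2g}=\Omega^wf^g$). The conformal metric is $\mathbf{g}=\sigma_g^2g\in\Gamma(S^2T^*M[2])$, with $\sigma_g\in\Gamma(\mathcal{E}[1])$ represented by $1$ in the scale $g$. For $g\in\boldsymbol{c}$, the Levi-Civita connection acts on $\mathcal{E}[w]$ by $\nabla\tau=\sigma_g^wd(\sigma_g^{-w}\tau)$; $\Delta=\mathbf{g}^{ab}\nabla_a\nabla_b$; the Schouten tensor $P_{ab}$ satisfies $\mathrm{Ric}_{ab}=(d-2)P_{ab}+J\mathbf{g}_{ab}$, $J=\mathbf{g}^{ab}P_{ab}$. The standard tractor bundle $\mathcal{T}$ is identified by $g\in\boldsymbol{c}$ with $\mathcal{E}[1]\oplus T^*M[1]\oplus\mathcal{E}[-1]$;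 for $\widehat g=\Omega^2g$, $\Upsilon=\Omega^{-1}d\Omega$: $\widehat\sigma=\sigma$, $\widehat\mu_b=\mu_b+\Upsilon_b\sigma$, $\widehat\rho=\rho-\Upsilon^b\mu_b-\frac12\Upsilon^b\Upsilon_b\sigma$. Tractor connection: $\nabla_a(\sigma,\mu_b,\rho)=(\nabla_a\sigma-\mu_a,\nabla_a\mu_b+\mathbf{g}_{ab}\rho+P_{ab}\sigma,\nabla_a\rho-P_{ab}\mu^b)$. Tractor metric $h$: quadratic form $2\sigma\rho+\mathbf{g}^{ab}\mu_a\mu_b$. For $\sigma\in\Gamma(\mathcal{E}[1])$ the scale tractor is $I=\frac1dD\sigma\stackrel{g}{=}(\sigma,\nabla_a\sigma,-\frac1d(\Delta\sigma+J\sigma))$; $I^2=h(I,I)$. $(M,\boldsymbol{c},I)$ is almost pseudo-Riemannian if $I$ is nowhere zero. For a nondegenerate hypersurface $\Sigma$ with weight $1$ conormal $n_a$, $\mathbf{g}^{ab}n_an_b=\pm1$, the second fundamental form in the scale $g$ is $L_{ab}=\nabla_an_b\mp n_an^c\nabla_cn_b$ along $\Sigma$. $\Sigma$ is totally umbilic if the trace-free part (with respect to the induced conformal metric on $\Sigma$) of $L_{ab}$ vanishes at all points of $\Sigma$; this is independent of $g\in\boldsymbol{c}$. *)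

(* Defs.v *)
(* Smooth manifolds are given by a maximal smooth atlas, and tensor fields by
   their components in every chart, subject to the transformation law under a
   change of chart.  Conformally weighted objects are given, for each metric g
   of the conformal class, by their representative in the scale g; in that
   trivialisation the conformal metric is g itself and the Levi-Civita
   connection of g acts on weighted fields as on unweighted ones. *)
From HB Require Import structures.
From mathcomp Require Import all_boot all_order all_algebra.
From mathcomp Require Import all_classical all_reals all_analysis.

Set Implicit Arguments.
Unset Strict Implicit.
Unset Printing Implicit Defensive.

Import Order.TTheory GRing.Theory Num.Theory.
Import numFieldNormedType.Exports.

Local Open Scope classical_set_scope.
Local Open Scope ring_scope.

Section Euclidean.
Variables (R : realType) (d : nat).

Definition partial (i : 'I_d) (f : 'rV[R]_d -> R) : 'rV[R]_d -> R :=
  fun u => 'D_('e_i) f u.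

(* All iterated partial derivatives exist and are differentiable on U; this is
   C^oo for U open. *)
Definition smooth_on (U : set 'rV[R]_d) (f : 'rV[R]_d -> R) : Prop :=
  forall (s : seq 'I_d) (u : 'rV[R]_d), U u ->
    differentiable (foldr partial f s) u.

End Euclidean.

Section Manifold.
Variables (R : realType) (d : nat).

Record chart (T : topologicalType) := Chart {
  dom : set T;
  cod : set 'rV[R]_d;
  coord : T -> 'rV[R]_d;
  point : 'rV[R]_d -> T;
  dom_open : open dom;
  cod_open : open cod;
  coord_cod : forall x, dom x -> cod (coord x);
  point_dom : forall u, cod u -> dom (point u);
  coordK : forall x, dom x -> point (coord x) = x;
  pointK : forall u, cod u -> coord (point u) = u;
  coord_continuous : forall x, dom x -> {for x, continuous coord};
  point_continuous : forall u, cod u -> {for u, continuous point} }.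

Definition smooth_transition (T : topologicalType) (phi psi : chart T) : Prop :=
  forall k : 'I_d,
    smooth_on [set u | cod phi u /\ dom psi (point phi u)]
              (fun u => coord psi (point phi u) 0 k).

Definition compatible (T : topologicalType) (phi psi : chart T) : Prop :=
  smooth_transition phi psi /\ smooth_transition psi phi.

Record manifold := Manifold {
  carrier :> topologicalType;
  atlas : set (chart carrier);
  manifold_hausdorff : hausdorff_space carrier;
  manifold_second_countable : @second_countable carrier;
  atlas_cover : forall x : carrier, exists2 phi, atlas phi & dom phi x;
  atlas_compatible : forall phi psi, atlas phi -> atlas psi ->
    compatible phi psi;
  atlas_maximal : forall phi, (forall psi, atlas psi -> compatible phi psi) ->
    atlas phi }.

End Manifold.

Section Tensors.
Variables (R : realType) (d : nat) (M : manifold R d).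

Definition covector := chart R d M -> M -> 'rV[R]_d.
Definition cotensor2 := chart R d M -> M -> 'M[R]_d.

(* The i-th coordinate vector field of the chart phi, acting on functions. *)
Definition pd (phi : chart R d M) (i : 'I_d) (f : M -> R) (x : M) : R :=
  partial i (fun u => f (point phi u)) (coord phi x).

(* jac phi psi x i k is the partial derivative, along the i-th coordinate of
   phi, of the k-th coordinate of psi. *)
Definition jac (phi psi : chart R d M) (x : M) : 'M[R]_d :=
  \matrix_(i, k) pd phi i (fun y => coord psi y 0 k) x.

Definition smooth_in (V : set M) (phi : chart R d M) (f : M -> R) : Prop :=
  smooth_on [set u | cod phi u /\ V (point phi u)] (fun u => f (point phi u)).

Definition smooth_fun (V : set M) (f : M -> R) : Prop :=
  forall phi, atlas phi -> smooth_in V phi f.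

Definition covector_field (V : set M) (w : covector) : Prop :=
  (forall phi, atlas phi -> forall i, smooth_in V phi (fun x => w phi x 0 i)) /\
  (forall phi psi x, atlas phi -> atlas psi ->
     dom phi x -> dom psi x -> V x ->
     w phi x = w psi x *m (jac phi psi x)^T).

Definition cotensor2_field (V : set M) (h : cotensor2) : Prop :=
  (forall phi, atlas phi -> forall i j,
     smooth_in V phi (fun x => h phi x i j)) /\
  (forall phi psi x, atlas phi -> atlas psi ->
     dom phi x -> dom psi x -> V x ->
     h phi x = jac phi psi x *m h psi x *m (jac phi psi x)^T).

Definition metric (p : nat) (g : cotensor2) : Prop :=
  cotensor2_field setT g /\
  (forall phi x, atlas phi -> dom phi x ->
     exists2 P : 'M[R]_d, P \in unitmx &
       P *m g phi x *m P^T
       = diag_mx (\row_(i < d) (if (i < p)%N then 1 else -1))).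

(* Trace and pairing of covariant tensors with respect to the inverse of the
   symmetric matrix G. *)
Definition gtrace (G A : 'M[R]_d) : R := \tr (invmx G *m A).
Definition gpair (G : 'M[R]_d) (u v : 'rV[R]_d) : R :=
  (u *m invmx G *m v^T) 0 0.

Definition diff_fun (f : M -> R) : covector :=
  fun phi x => \row_i pd phi i f x.

Section LeviCivita.
Variables (g : cotensor2) (phi : chart R d M).

(* The Christoffel symbol with upper index k and lower indices i, j. *)
Definition christoffel (k i j : 'I_d) (x : M) : R :=
  2^-1 * \sum_l invmx (g phi x) k l *
    (pd phi i (fun y => g phi y j l) x + pd phi j (fun y => g phi y i l) x
     - pd phi l (fun y => g phi y i j) x).

Definition cov_deriv (w : covector) (x : M) : 'M[R]_d :=
  \matrix_(a, b) (pd phi a (fun y => w phi y 0 b) x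
                  - \sum_k christoffel k a b x * w phi x 0 k).

Definition laplacian (f : M -> R) (x : M) : R :=
  gtrace (g phi x) (cov_deriv (diff_fun f) x).

(* Sign convention: positive on round spheres. *)
Definition ricci (x : M) : 'M[R]_d :=
  \matrix_(i, j) \sum_k
    (pd phi k (christoffel k i j) x - pd phi j (christoffel k i k) x
     + \sum_l (christoffel k k l x * christoffel l i j x
               - christoffel k j l x * christoffel l i k x)).

(* J and P are the solution of Ric = (d - 2) P + J g, J = tr P: see
   ricci_schouten and J_schouten. *)
Definition schouten_trace (x : M) : R :=
  gtrace (g phi x) (ricci x) / (2 * (d%:R - 1)).

Definition schouten (x : M) : 'M[R]_d :=
  (d%:R - 2)^-1 *: (ricci x - schouten_trace x *: g phi x).

Lemma ricci_schouten (x : M) : (2 < d)%N ->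
  ricci x = (d%:R - 2) *: schouten x + schouten_trace x *: g phi x.
Proof.
move=> d2; rewrite /schouten scalerA divff ?scale1r ?subrK //.
by rewrite subr_eq0 (eqr_nat R) neq_ltn d2 orbT.
Qed.

Lemma J_schouten (x : M) : (2 < d)%N -> g phi x \in unitmx ->
  schouten_trace x = gtrace (g phi x) (schouten x).
Proof.
move=> d2 gU.
have d20 : d%:R - 2 != 0 :> R.
  by rewrite subr_eq0 (eqr_nat R) neq_ltn d2 orbT.
have d10 : d%:R - 1 != 0 :> R.
  by rewrite subr_eq0 (eqr_nat R _ 1) neq_ltn (ltnW d2) orbT.
rewrite /schouten /gtrace -scalemxAr mulmxBr -scalemxAr mulVmx //.
rewrite linearZ linearB linearZ /= mxtrace1 -/(gtrace _ _).
have -> : gtrace (g phi x) (ricci x)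
    = schouten_trace x * (2 * (d%:R - 1)).
  by rewrite /schouten_trace divfK // mulf_neq0 // pnatr_eq0.
apply: (mulfI d20); rewrite mulVKf // -mulrBr mulrC; congr (_ * _).
by rewrite mulrBr mulr1 mulr_natl mulr2n addrAC addrK.
Qed.

End LeviCivita.

(* gh = Om^2 g with Om a positive smooth function. *)
Definition rescaling (g : cotensor2) (Om : M -> R) (gh : cotensor2) : Prop :=
  [/\ smooth_fun setT Om, (forall x, 0 < Om x) &
      forall phi x, atlas phi -> dom phi x ->
        gh phi x = Om x ^+ 2 *: g phi x].

Definition conformal_class (p : nat) (c : set cotensor2) : Prop :=
  exists2 g, metric p g & c = [set gh | exists Om, rescaling g Om gh].

(* Sections of E[w]. *)
Definition density (c : set cotensor2) (w : int)
    (f : cotensor2 -> M -> R) : Prop :=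
  (forall g, c g -> smooth_fun setT (f g)) /\
  (forall g gh Om, c g -> c gh -> rescaling g Om gh ->
     forall x, f gh x = Om x ^ w * f g x).

(* Sections of T*M[w] over V. *)
Definition covector_density (c : set cotensor2) (w : int) (V : set M)
    (n : cotensor2 -> covector) : Prop :=
  (forall g, c g -> covector_field V (n g)) /\
  (forall g gh Om, c g -> c gh -> rescaling g Om gh ->
     forall phi x, atlas phi -> dom phi x -> V x ->
       n gh phi x = Om x ^ w *: n g phi x).

(* A standard tractor at a point in a scale and a chart: the slots are
   (sigma, mu_b, rho), of weights 1, 1, -1.  Tractor indices are lowered with
   the tractor metric. *)
Record tractor := Tractor { tsig : R; tmu : 'rV[R]_d; trho : R }.

Definition tscale (a : R) (t : tractor) : tractor :=
  Tractor (a * tsig t) (a *: tmu t) (a * trho t).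

(* The change of slots from the scale G to the scale Om^2 G, at a point, for
   tractors of weight w; Ups is the logarithmic differential of Om. *)
Definition tractor_rescale (w : int) (G : 'M[R]_d) (Om : R) (Ups : 'rV[R]_d)
    (t : tractor) : tractor :=
  Tractor (Om ^ (w + 1) * tsig t)
          (Om ^ (w + 1) *: (tmu t + tsig t *: Ups))
          (Om ^ (w - 1) * (trho t - gpair G Ups (tmu t)
                           - 2^-1 * gpair G Ups Ups * tsig t)).

(* h(t, t) *)
Definition tractor_norm (G : 'M[R]_d) (t : tractor) : R :=
  2 * tsig t * trho t + gpair G (tmu t) (tmu t).

(* The connection applied to the section t, in the direction a. *)
Definition tractor_connection (g : cotensor2) (t : chart R d M -> M -> tractor)
    (phi : chart R d M) (x : M) (a : 'I_d) : tractor :=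
  let P := schouten g phi x in
  Tractor (pd phi a (fun y => tsig (t phi y)) x - tmu (t phi x) 0 a)
          (\row_b (cov_deriv g phi (fun psi y => tmu (t psi y)) x a b
                   + g phi x a b * trho (t phi x) + P a b * tsig (t phi x)))
          (pd phi a (fun y => trho (t phi y)) x
           - gpair (g phi x) (row a P) (tmu (t phi x))).

(* Smooth tractor-valued 1-forms f_{aB} of weight w; a is the last argument
   of f. *)
Definition tractor_form (c : set cotensor2) (w : int)
    (f : cotensor2 -> chart R d M -> M -> 'I_d -> tractor) : Prop :=
  (forall g, c g ->
     [/\ covector_field setT (fun phi x => \row_a tsig (f g phi x a)),
         cotensor2_field setT
           (fun phi x => \matrix_(a, b) tmu (f g phi x a) 0 b) &
         covector_field setT (fun phi x => \row_a trho (f g phi x a))]) /\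
  (forall g gh Om, c g -> c gh -> rescaling g Om gh ->
     forall phi x a, atlas phi -> dom phi x ->
       f gh phi x a =
         tractor_rescale w (g phi x) (Om x) ((Om x)^-1 *: diff_fun Om phi x)
           (f g phi x a)).

(* I = (1/d) D sigma *)
Definition scale_tractor (sigma : cotensor2 -> M -> R) (g : cotensor2)
    (phi : chart R d M) (x : M) : tractor :=
  Tractor (sigma g x) (diff_fun (sigma g) phi x)
    (- (d%:R)^-1 * (laplacian g phi (sigma g) x
                    + schouten_trace g phi x * sigma g x)).

Definition almost_pseudo_Riemannian (c : set cotensor2)
    (sigma : cotensor2 -> M -> R) : Prop :=
  density c 1 sigma /\
  (forall g phi x, c g -> atlas phi -> dom phi x ->
     scale_tractor sigma g phi x <> Tractor 0 0 0).

Definition zero_locus (c : set cotensor2) (sigma : cotensor2 -> M -> R) :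
    set M :=
  [set x | forall g, c g -> sigma g x = 0].

Section Hypersurface.
Variables (c : set cotensor2) (S : set M).

Definition slice_chart (phi : chart R d M) (j : 'I_d) : Prop :=
  atlas phi /\ (forall x, dom phi x -> (S x <-> coord phi x 0 j = 0)).

Definition hypersurface : Prop :=
  forall x, S x -> exists phi j, slice_chart phi j /\ dom phi x.

(* In a slice chart (phi, j) the tangent spaces of S are spanned by the
   coordinate vectors of index different from j, so that the metric induced
   on S is obtained by deleting row and column j. *)
Definition nondegenerate : Prop :=
  forall g phi j x, c g -> slice_chart phi j -> dom phi x -> S x ->
    row' j (col' j (g phi x)) \in unitmx.

(* n is a weight 1 covector field on the open set V whose restriction to S is
   a conormal of S with square eps. *)
Definition unit_conormal (V : set M) (eps : R) (n : cotensor2 -> covector) :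
    Prop :=
  [/\ open V, covector_density c 1 V n,
      (forall g phi j x, c g -> slice_chart phi j -> dom phi x -> S x -> V x ->
         forall i, i != j -> n g phi x 0 i = 0) &
      (forall g phi x, c g -> atlas phi -> dom phi x -> S x -> V x ->
         gpair (g phi x) (n g phi x) (n g phi x) = eps)].

(* L_ab, as a tensor on M along S annihilating the normal. *)
Definition second_fundamental_form (eps : R) (n : cotensor2 -> covector)
    (g : cotensor2) (phi : chart R d M) (x : M) : 'M[R]_d :=
  let N := n g phi x in
  let DN := cov_deriv g phi (n g) x in
  DN - eps *: (N^T *m (N *m invmx (g phi x) *m DN)).

(* For A annihilating the normal along S, with eps N^T N the normal part of
   the metric, this is the trace-free part of A with respect to the induced
   metric on S, whose dimension is d - 1. *)
Definition trace_free_part (eps : R) (N : 'rV[R]_d) (G A : 'M[R]_d) :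
    'M[R]_d :=
  let induced := G - eps *: (N^T *m N) in
  let N_up := N *m invmx G in
  let induced_inv := invmx G - eps *: (N_up^T *m N_up) in
  A - (\tr (induced_inv *m A) / (d%:R - 1)) *: induced.

(* Unit conormals exist locally on nondegenerate hypersurfaces, but not
   globally unless S is two-sided. *)
Definition totally_umbilic_hypersurface : Prop :=
  [/\ hypersurface, nondegenerate &
      forall V eps n, (eps = 1 \/ eps = -1) -> unit_conormal V eps n ->
        forall g phi x, c g -> atlas phi -> dom phi x -> S x -> V x ->
          trace_free_part eps (n g phi x) (g phi x)
            (second_fundamental_form eps n g phi x) = 0].

End Hypersurface.

End Tensors.

(* Main.v *)
From Pilot Require Import Defs.
From HB Require Import structures.
From mathcomp Require Import all_boot all_order all_algebra.
From mathcomp Require Import all_classical all_reals all_analysis.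
From mathcomp Require Import ring lra.
Import Order.TTheory GRing.Theory Num.Theory.
Import numFieldNormedType.Exports.
Local Open Scope classical_set_scope.
Local Open Scope ring_scope.

(* On S the condition I^2 = eps reads g(d sigma, d sigma) = eps, so d sigma does
   not vanish there: sigma can replace a coordinate of a chart, S is a
   hypersurface, and it is nondegenerate because d sigma is not null.  The middle
   slot of nabla I = sigma f says that the Hessian of sigma is a multiple of g
   along S.  A unit conormal n agrees with d sigma up to a sign along S, so the
   tangential derivative of n is, up to that sign, the tangential part of the
   Hessian of sigma, that is, a multiple of the induced metric. *)

Set Implicit Arguments.
Unset Strict Implicit.
Unset Printing Implicit Defensive.

(** * Iterated partial derivatives *)

(** Two obstacles shape the proof. A hypersurface must come with slice charts of the maximal atlas,
    so the change of coordinates that turns sigma into a coordinate needs a smooth inverse. As it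
    alters a single coordinate, monotonicity and the intermediate value theorem along that direction
    give the inverse, and smoothness follows by bootstrapping a formula for its first derivatives.
    The second obstacle is that the conormal is controlled only along S and its sign relative to d
    sigma is obtained point by point, with no continuity known. The sign is therefore never
    differentiated: products of two components do not see it, and a Lagrange multiplier argument
    compares their derivatives. *)

Section Differentiable.
Variables (R : numFieldType) (V W : normedModType R).

Lemma is_diff_near_linear (f : V -> W) (x : V) (L : {linear V -> W}) :
  continuous L ->
  (forall e, 0 < e -> \forall h \near (0 : V),
     `|f (h + x) - f x - L h| <= e * `|h|) ->
  is_diff x f L.
Proof.
move=> cL H.
have key : f \o shift x = cst (f x) + L +o_ 0 id.
  apply/eqaddoP => e e0; have := H e e0.
  by apply: filterS => h /= E; rewrite !fctE /= opprD addrA.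
apply: DiffDef; last exact: diff_unique.
by apply/diff_locallyP; rewrite (diff_unique cL key).
Qed.

Lemma near_diff (f : V -> W) (x : V) : differentiable f x -> forall e, 0 < e ->
  \forall h \near (0 : V), `|f (h + x) - f x - 'd f x h| <= e * `|h|.
Proof.
move=> /diff_locallyP[_ /eqaddoP df] e /df.
by apply: filterS => h /=; rewrite !fctE /= opprD addrA.
Qed.

Lemma near_eq_differentiable (f g : V -> W) (x : V) :
  (\near x, f x = g x) -> differentiable g x -> differentiable f x.
Proof.
move=> fg dg.
suff [] : is_diff x f ('d g x) by [].
apply: is_diff_near_linear; first exact: diff_continuous.
move=> e e0; have := near_diff dg e0.
have : \forall h \near (0 : V), f (h + x) = g (h + x).
  by move: fg; rewrite (near_shift 0) subr0.
by apply: filterS2 => h /= ->; rewrite (nbhs_singleton fg).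
Qed.

End Differentiable.

Section RowCalculus.
Variables (R : realType) (d : nat).
Implicit Types (f g : 'rV[R]_d -> R) (x u v : 'rV[R]_d) (U W : set 'rV[R]_d).
Implicit Type G : 'rV[R]_d -> 'rV[R]_d.

(** Linear forms given by their coefficient column, bundled as linear maps so that [is_diff] accepts
    them as differentials. *)
Definition row_pair (a : 'cV[R]_d) u : R := (u *m a) 0 0.

Lemma row_pair_linear (a : 'cV[R]_d) : linear (row_pair a).
Proof. by move=> k u v; rewrite /row_pair mulmxDl -scalemxAl !mxE. Qed.

HB.instance Definition _ (a : 'cV[R]_d) :=
  GRing.isLinear.Build R 'rV[R]_d R _ (row_pair a) (row_pair_linear a).

Lemma row_pair_continuous (a : 'cV[R]_d) : continuous (row_pair a).
Proof.
have -> : row_pair a = \sum_k (fun u => u 0 k *: a k 0).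
  by apply/funext => u; rewrite fct_sumE /row_pair mxE.
move=> u; apply: differentiable_continuous; apply: differentiable_sum => k.
by apply: differentiableZl; exact: differentiable_coord.
Qed.

Lemma is_diff_near_row_pair f x (a : 'cV[R]_d) :
  (forall e, 0 < e -> \forall h \near (0 : 'rV[R]_d),
     `|f (h + x) - f x - row_pair a h| <= e * `|h|) ->
  is_diff x f (row_pair a).
Proof.
exact/is_diff_near_linear/row_pair_continuous.
Qed.

Lemma partial_row_pair f x (a : 'cV[R]_d) k :
  is_diff x f (row_pair a) -> partial k f x = a k 0.
Proof.
move=> [df val]; rewrite /partial deriveE // val /row_pair.
by rewrite -rowE mxE.
Qed.

Lemma diffE_partial f x u : differentiable f x ->
  'd f x u = \sum_k u 0 k * partial k f x.
Proof.
move=> df; rewrite {1}(row_sum_delta u) linear_sum; apply: eq_bigr => k _.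
by rewrite linearZ /= /partial deriveE.
Qed.

Lemma near_diff_partial f x : differentiable f x -> forall e, 0 < e ->
  \forall h \near (0 : 'rV[R]_d),
     `|f (h + x) - f x - \sum_k h 0 k * partial k f x| <= e * `|h|.
Proof.
by move=> df e /(near_diff df); apply: filterS => h; rewrite diffE_partial.
Qed.

Lemma differentiable_row G x :
  (forall k, differentiable (fun u => G u 0 k) x) -> differentiable G x.
Proof.
move=> dG.
have -> : G = \sum_k (fun u => G u 0 k *: 'e_k).
  by apply/funext => u; rewrite fct_sumE -row_sum_delta.
by apply: differentiable_sum => k; exact: differentiableZl.
Qed.

Lemma partial_comp f G i x :
  (forall k, differentiable (fun u => G u 0 k) x) -> differentiable f (G x) ->
  partial i (f \o G) x =
  \sum_k partial i (fun u => G u 0 k) x * partial k f (G x).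
Proof.
move=> dGk df; have dG := differentiable_row dGk.
rewrite /partial deriveE; last exact: differentiable_comp.
rewrite diff_comp //= diffE_partial //; apply: eq_bigr => k _.
congr (_ * _); rewrite -deriveE // derive_mx ?mxE //.
exact: diff_derivable.
Qed.

(** Graded form of [smooth_on], which makes induction on the order possible; the partial derivatives
    up to order n are differentiable. *)
Fixpoint Ck (n : nat) U f : Prop :=
  (forall u, U u -> differentiable f u) /\
  if n is m.+1 then forall i, Ck m U (partial i f) else True.

Lemma Ck_diff n U f u : Ck n U f -> U u -> differentiable f u.
Proof. by case: n => [|n] /= [H _]; apply: H. Qed.

Lemma smooth_onP U f : smooth_on U f <-> forall n, Ck n U f.
Proof.
split.
  move=> H n; elim: n f H => [|n IH] f H /=; (split; first by move=> u; apply: (H [::])) => //.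
  move=> i; apply: IH => s u Uu.
  by have := H (rcons s i) u Uu; rewrite foldr_rcons.
move=> H s; elim/last_ind: s f H => [|s i IH] f H u Uu.
  exact: (Ck_diff (H 0%N)).
rewrite foldr_rcons; apply: IH => // n.
by have [_] := H n.+1; exact.
Qed.

Lemma CkW n U f : Ck n.+1 U f -> Ck n U f.
Proof.
elim: n f => [|n IH] f [H1 H2]; split => // i.
exact: IH (H2 i).
Qed.

Lemma Ck_eq n U f g : open U -> (forall u, U u -> f u = g u) ->
  Ck n U g -> Ck n U f.
Proof.
move=> oU; have nU u : U u -> nbhs u U by move=> Uu; exact: open_nbhs_nbhs.
elim: n f g => [|n IH] f g fg [H1 H2].
  split=> // u Uu; apply: near_eq_differentiable (H1 _ Uu).
  by apply: filterS (nU _ Uu).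
split=> [u Uu | i].
  apply: near_eq_differentiable (H1 _ Uu).
  by apply: filterS (nU _ Uu).
apply: IH (H2 i) => u Uu; apply: near_eq_derive.
by apply: filterS (nU _ Uu).
Qed.

Lemma CkD n U f g : open U -> Ck n U f -> Ck n U g -> Ck n U (f + g).
Proof.
move=> oU Hf Hg.
elim: n f g Hf Hg => [|n IH] f g [f1 f2] [g1 g2].
  by split=> // u Uu; apply: differentiableD; [exact: f1 | exact: g1].
split=> [u Uu | i]; first by apply: differentiableD; [exact: f1 | exact: g1].
apply: Ck_eq (IH _ _ (f2 i) (g2 i)) => // u Uu.
by rewrite /partial deriveD //; apply: diff_derivable; [exact: f1 | exact: g1].
Qed.

Lemma Ck_cst n U (a : R) : Ck n U (cst a).
Proof.
elim: n a => [|n IH] a; first by split=> // u _; exact: differentiable_cst.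
split=> [u _|i]; first exact: differentiable_cst.
suff -> : partial i (cst a) = cst 0 :> ('rV[R]_d -> R) by [].
by apply/funext => u; rewrite /partial derive_cst.
Qed.

Lemma Ck_sum n U (I : Type) (r : seq I) (P : pred I) (F : I -> 'rV[R]_d -> R) :
  open U -> (forall i, Ck n U (F i)) -> Ck n U (fun u => \sum_(i <- r | P i) F i u).
Proof.
move=> oU H.
have -> : (fun u => \sum_(i <- r | P i) F i u) = \sum_(i <- r | P i) F i.
  by apply/funext => u; rewrite fct_sumE.
elim/big_rec : _ => [|i f _ IH]; first exact: Ck_cst.
exact: CkD.
Qed.

Lemma CkM n U f g : open U -> Ck n U f -> Ck n U g -> Ck n U (fun u => f u * g u).
Proof.
move=> oU; elim: n f g => [|n IH] f g Hf Hg.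
  by split=> // u Uu; apply: differentiableM; [case: Hf | case: Hg] => H _; apply: H.
have [f1 f2] := Hf; have [g1 g2] := Hg.
split=> [u Uu | i]; first by apply: differentiableM; [exact: f1 | exact: g1].
apply: (@Ck_eq _ _ _ ((fun u => f u * partial i g u) + (fun u => g u * partial i f u))) => //.
  by move=> u Uu; rewrite /partial deriveM //; apply: diff_derivable; [exact: f1 | exact: g1].
by apply: CkD => //; apply: IH; [exact: CkW Hf | exact: g2 | exact: CkW Hg | exact: f2].
Qed.

Lemma CkN n U f : open U -> Ck n U f -> Ck n U (fun u => - f u).
Proof.
move=> oU Hf; apply: (@Ck_eq _ _ _ (fun u => (cst (-1) u) * f u)) => //.
  by move=> u _; rewrite /= mulN1r.
by apply: CkM => //; exact: Ck_cst.
Qed.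

(** The derivative of 1/f is a polynomial in 1/f and a partial derivative of f, so order n for 1/f
    yields order n + 1. *)
Lemma CkV n U f : open U -> (forall u, U u -> f u != 0) -> Ck n U f ->
  Ck n U (fun u => (f u)^-1).
Proof.
move=> oU f0; elim: n => [|n IH] Hf.
  by split=> // u Uu; apply: differentiableV (f0 _ Uu); exact: (Ck_diff Hf Uu).
have [f1 f2] := Hf; split=> [u Uu | i].
  by apply: differentiableV (f0 _ Uu); exact: f1.
have HV := IH (CkW Hf).
apply: (@Ck_eq _ _ _ (fun u => - ((f u)^-1 * (f u)^-1 * partial i f u))) => //.
  move=> u Uu; rewrite /partial deriveV ?f0 //; last by apply: diff_derivable; exact: f1.
  by rewrite scaleNr expr2 invfM.
apply: CkN => //; apply: CkM => //; first exact: CkM.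
exact: f2.
Qed.

Lemma Ck_coord n U k : open U -> Ck n U (fun u => u 0 k).
Proof.
move=> oU; have Hd u : differentiable (fun u : 'rV[R]_d => u 0 k) u.
  exact: differentiable_coord.
case: n => [|n]; split=> // i.
have -> : partial i (fun u => u 0 k) = cst (('e_i : 'rV[R]_d) 0 k).
  apply/funext => u; rewrite /partial /=.
  have /matrixP/(_ 0 k) := @derive_mx R 'rV[R]_d 1 d id u 'e_i (@derivable_id _ _ _ _).
  by rewrite derive_id [in RHS]mxE /= => ->.
exact: Ck_cst.
Qed.

(** The chain rule writes a partial derivative of [f \o G] through derivatives of G and composites
    [partial k f \o G], so the induction varies f and keeps G. *)
Lemma Ck_comp n U W f G : open U -> (forall u, U u -> W (G u)) ->
  (forall k, Ck n U (fun u => G u 0 k)) -> Ck n W f -> Ck n U (f \o G).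
Proof.
move=> oU UW; have D m g : (forall k, Ck m U (fun u => G u 0 k)) -> Ck m W g ->
    forall u, U u -> differentiable (g \o G) u.
  move=> HG Hg u Uu; apply: differentiable_comp.
    by apply: differentiable_row => k; exact: Ck_diff (HG k) Uu.
  exact: Ck_diff Hg (UW _ Uu).
elim: n f => [|n IH] f HG Hf.
  by split=> //; exact: D HG Hf.
split=> [|i]; first exact: D HG Hf.
apply: (@Ck_eq _ _ _ (fun u => \sum_k partial i (fun u => G u 0 k) u * (partial k f \o G) u)) => //.
  move=> u Uu; rewrite partial_comp //; last exact: Ck_diff Hf (UW _ Uu).
  by move=> k; exact: Ck_diff (HG k) Uu.
apply: Ck_sum => // k; apply: CkM => //; first by have [_] := HG k; exact.
by apply: IH => [l|]; [exact: CkW | have [_] := Hf; exact].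
Qed.

Lemma smooth_on_comp U W f G : open U -> (forall u, U u -> W (G u)) ->
  (forall k, smooth_on U (fun u => G u 0 k)) -> smooth_on W f ->
  smooth_on U (f \o G).
Proof.
move=> oU UW HG /smooth_onP Hf; apply/smooth_onP => n.
by apply: Ck_comp (Hf n) => // k; exact: (smooth_onP _ _).1.
Qed.

Lemma smooth_on_eq U f g : open U -> (forall u, U u -> f u = g u) ->
  smooth_on U g -> smooth_on U f.
Proof.
move=> oU fg /smooth_onP Hg; apply/smooth_onP => n; exact: Ck_eq (Hg n).
Qed.

Lemma smooth_on_sub U W f : U `<=` W -> smooth_on W f -> smooth_on U f.
Proof. by move=> UW H s u /UW; exact: H. Qed.

Lemma smooth_on_coord U k : open U -> smooth_on U (fun u => u 0 k).
Proof. by move=> oU; apply/smooth_onP => n; exact: Ck_coord. Qed.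

Lemma smooth_on_continuous U f u : smooth_on U f -> U u -> {for u, continuous f}.
Proof. by move=> H Uu; apply: differentiable_continuous; exact: (H [::]). Qed.

Lemma smooth_on_partial U f i : smooth_on U f -> smooth_on U (partial i f).
Proof. by move=> H s u Uu; have := H (rcons s i) u Uu; rewrite foldr_rcons. Qed.

End RowCalculus.

(** * Straightening a function by a change of one coordinate *)

Lemma is_derive_line (R : realType) (V W : normedModType R) (F : V -> W)
    (u e : V) (t : R) :
  differentiable F (u + t *: e) ->
  is_derive t 1 (fun t => F (u + t *: e)) ('D_e F (u + t *: e)).
Proof.
move=> dF.
have dG : is_diff t (fun t : R => u + t *: e) (fun t : R => t *: e).
  have := is_diffD (is_diff_cst u t) (is_diff_scalel t e).
  by rewrite add0r.
have dFG : differentiable (F \o (fun t : R => u + t *: e)) t.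
  by apply: differentiable_comp => //; exact: ex_diff.
apply: DeriveDef; first exact: diff_derivable.
rewrite deriveE // [X in X _ = _](diff_comp (f := fun t : R => u + t *: e) _ dF) //= deriveE //.
by rewrite (diff_val (f := fun t : R => u + t *: e)) scale1r.
Qed.

Lemma row_coord_le_norm (R : realFieldType) (d : nat) (u : 'rV[R]_d) k :
  `|u 0 k| <= `|u|.
Proof. by rewrite [leRHS]/Num.Def.normr/= mx_normrE; apply: (le_bigmax _ _ (0, k)). Qed.

Section Straightening.
Variables (R : realType) (d : nat) (u0 : 'rV[R]_d) (r : R).
Variables (F : 'rV[R]_d -> R) (j : 'I_d).
Hypothesis r0 : 0 < r.
Let B : set 'rV[R]_d := ball u0 r.
Hypothesis FB : smooth_on B F.
Hypothesis Fj : forall u, B u -> 0 < partial j F u.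
Implicit Types (u v h : 'rV[R]_d) (s t : R).

Let e : 'rV[R]_d := 'e_j.

Let BP u : B u <-> forall k, `|u0 0 k - u 0 k| < r.
Proof.
split=> [[_ H] k | H]; first exact: H.
by split=> // i k; rewrite (ord1 i); exact: H.
Qed.

Let dF u : B u -> differentiable F u. Proof. exact: (FB [::]). Qed.

(** The norm on row vectors is the maximum norm, so B is a box and membership can be checked
    coordinate by coordinate. *)
Let B_segment u s t : B u -> B (u + s *: e) -> 0 <= t <= s -> B (u + t *: e).
Proof.
move=> /BP H1 /BP H2 /andP[t0 ts]; apply/BP => k; have := H1 k; have := H2 k.
rewrite !mxE eqxx /= !ltr_norml.
by case: (k == j); rewrite ?mulr1 ?mulr0 => /andP[? ?] /andP[? ?];
  apply/andP; split; lra.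
Qed.

Let F_incr u s : B u -> B (u + s *: e) -> 0 < s -> F u < F (u + s *: e).
Proof.
move=> Bu Bus s0; pose q t := F (u + t *: e).
have dq t : 0 <= t <= s -> is_derive t 1 q (partial j F (u + t *: e)).
  by move=> ts; apply: is_derive_line; apply: dF; exact: B_segment Bus ts.
have [t ts||t ts E] := MVT s0 (f := q) (df := fun t => partial j F (u + t *: e)).
- by apply: dq; move: ts; rewrite in_itv /= => /andP[/ltW -> /ltW ->].
- by apply: derivable_within_continuous => t; rewrite in_itv /= => /dq[].
have -> : F u = q 0 by rewrite /q scale0r addr0.
rewrite -subr_gt0 E subr0 mulr_gt0 //; apply: Fj; apply: B_segment Bus _ => //.
by move: ts; rewrite in_itv /= => /andP[/ltW -> /ltW ->].
Qed.

(** The map that replaces the j-th coordinate by F, written as a displacement along e because F is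
    strictly increasing on such lines. *)
Definition straighten u : 'rV[R]_d := u + (F u - u 0 j) *: e.

Lemma straighten_coord u : straighten u 0 j = F u.
Proof. by rewrite !mxE !eqxx mulr1 addrC subrK. Qed.

(** Points with the same image differ by a multiple of e and have the same value of F, so strict
    monotonicity along e makes them equal. *)
Let straighten_inj u v : B u -> B v -> straighten u = straighten v -> u = v.
Proof.
move=> Bu Bv E; have EF : F u = F v by rewrite -!straighten_coord E.
have [s vE] : exists s, v = u + s *: e.
  exists (v 0 j - u 0 j); move/(congr1 (fun w => w - (F u - v 0 j) *: e)): E.
  rewrite /straighten -EF addrK => Ev; rewrite -[LHS]Ev -addrA -scalerBl.
  by congr (_ + _ *: _); ring.
have [s0|s0|s0] := ltgtP s 0.
- have Eu : u = v + (- s) *: e by rewrite vE -addrA -scalerDl subrr scale0r addr0.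
  have : F v < F u by rewrite Eu; apply: F_incr; rewrite -?Eu ?oppr_gt0.
  by rewrite EF ltxx.
- have : F u < F v by rewrite vE; apply: F_incr; rewrite -?vE.
  by rewrite EF ltxx.
- by rewrite vE s0 scale0r addr0.
Qed.

Let cF u : B u -> {for u, continuous F}.
Proof. by move=> /dF; exact: differentiable_continuous. Qed.

(* The intermediate value theorem along the j-th coordinate direction. *)
Let local_solve u dl : B u -> 0 < dl ->
  \forall h \near (0 : 'rV[R]_d), exists s,
    [/\ `|s| <= dl, B (u + h + s *: e) & F (u + h + s *: e) = F u + h 0 j].
Proof.
move=> Bu dl0.
(* Each of h and s e changes a coordinate by at most rho, so a margin of 2 rho keeps u + h + s e in
   the ball. *)
have [rho rho0 Hrho] : exists2 rho, 0 < rho & forall k, `|u0 0 k - u 0 k| + 2 * rho < r.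
  have : 0 < r - `|u0 - u| by rewrite subr_gt0; move: Bu; rewrite /B -ball_normE.
  move=> D0; exists ((r - `|u0 - u|) / 3); first by lra.
  move=> k; have := row_coord_le_norm (u0 - u) k.
  by rewrite !mxE; lra.
pose m : R := Num.min dl rho.
have m0 : 0 < m by rewrite lt_min dl0.
have mdl : m <= dl by rewrite ge_min lexx.
have mrho : m <= rho by rewrite ge_min lexx orbT.
have Bsh h s : (forall k, `|h 0 k| < rho) -> `|s| <= m -> B (u + h + s *: e).
  move=> hr sm; apply/BP => k; rewrite !mxE eqxx /=.
  have := Hrho k; have := hr k; rewrite ltr_norml => /andP[h1 h2].
  move: sm; rewrite ler_norml => /andP[s1 s2] H.
  have : `|u0 0 k - u 0 k| < r - 2 * rho by lra.
  rewrite !ltr_norml => /andP[a1 a2].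
  by case: (k == j); rewrite ?mulr1 ?mulr0; apply/andP; split; lra.
have h0 : forall k, `|(0 : 'rV[R]_d) 0 k| < rho by move=> k; rewrite mxE normr0.
have Bp : B (u + m *: e).
  by have := Bsh 0 m h0; rewrite addr0 gtr0_norm ?lexx //; exact.
have Bm : B (u + (- m) *: e).
  by have := Bsh 0 (- m) h0; rewrite addr0 normrN gtr0_norm ?lexx //; exact.
have Fp := F_incr Bu Bp m0.
have Fm : F (u + (- m) *: e) < F u.
  have := F_incr Bm (s := m); rewrite -addrA -scalerDl addNr scale0r addr0; exact.
have hsmall : nbhs (0 : 'rV[R]_d) [set h : 'rV[R]_d | forall k, `|h 0 k| < rho].
  apply/nbhs_ballP; exists rho => //= h [_ H] k.
  by have := H 0 k; rewrite mxE /ball /= sub0r normrN.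
(* For small h the difference F (u + h + s e) - (F u + h_j) at s = m and s = -m keeps the sign it
   has at h = 0; these opposite signs feed the intermediate value theorem. *)
have cvF (w : 'rV[R]_d) : B w ->
    F (h + w) - (F u + h 0 j) @[h --> (0 : 'rV[R]_d)] --> F w - F u.
  move=> Bw; have -> : F w - F u = F (0 + w) - (F u + (0 : 'rV[R]_d) 0 j).
    by rewrite add0r mxE addr0.
  have sc : {for 0, continuous (fun h : 'rV[R]_d => h + w)}.
    exact: (cvgD (@cvg_id _ _) (cvg_cst w)).
  have Fc : F (h + w) @[h --> (0 : 'rV[R]_d)] --> F (0 + w).
    by apply: (continuous_comp sc); rewrite add0r; exact: cF.
  exact: (cvgB Fc (cvgD (cvg_cst (F u)) (@coord_continuous R 1 d 0 j 0))).
have Hp : \forall h \near (0 : 'rV[R]_d), 0 < F (h + (u + m *: e)) - (F u + h 0 j).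
  by apply: (cvF _ Bp [set x | 0 < x]); apply: lt_nbhsr; rewrite subr_gt0.
have Hm : \forall h \near (0 : 'rV[R]_d), F (h + (u + (- m) *: e)) - (F u + h 0 j) < 0.
  by apply: (cvF _ Bm [set x | x < 0]); apply: lt_nbhsl; rewrite subr_lt0.
near=> h.
have hk : forall k, `|h 0 k| < rho by near: h.
have E1 : 0 < F (h + (u + m *: e)) - (F u + h 0 j) by near: h; exact: Hp.
have E2 : F (h + (u + (- m) *: e)) - (F u + h 0 j) < 0 by near: h; exact: Hm.
pose q t := F (u + h + t *: e).
have qc : {within `[- m, m], continuous q}.
  apply: derivable_within_continuous => t; rewrite in_itv /= -ler_norml => tm.
  by have /dF/is_derive_line[] : B (u + h + t *: e) by exact: Bsh.
have q1 : q (- m) <= F u + h 0 j.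
  by rewrite -subr_le0 /q; move: E2; rewrite addrA (addrC h) => /ltW.
have q2 : F u + h 0 j <= q m.
  by rewrite -subr_ge0 /q; move: E1; rewrite addrA (addrC h) => /ltW.
have [||s] := IVT (v := F u + h 0 j) _ qc.
- by rewrite -subr_ge0 opprK addr_ge0 // ltW.
- by rewrite ge_min le_max q1 q2 orbT.
rewrite in_itv /= -ler_norml => sm Es; exists s; split=> //.
  exact: le_trans mdl.
exact: Bsh.
Unshelve. all: by end_near. Qed.

(** Serves twice: existence of the preimage makes the image open, and the bound on s controls the
    inverse near [straighten u]. *)
Let straighten_local u dl : B u -> 0 < dl ->
  \forall h \near (0 : 'rV[R]_d), exists s,
    [/\ `|s| <= dl, B (u + h + s *: e), F (u + h + s *: e) = F u + h 0 j &
        straighten (u + h + s *: e) = straighten u + h].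
Proof.
move=> Bu dl0; apply: filterS (local_solve Bu dl0) => h [s [sdl Bs Fs]].
exists s; split=> //; rewrite /straighten Fs.
have -> : F u + h 0 j - (u + h + s *: e) 0 j = F u - u 0 j - s.
  by rewrite !mxE !eqxx mulr1; ring.
by rewrite scalerBl [_ - s *: e]addrC addrA addrK addrAC.
Qed.

(** Inverse by choice; u0 is a default value off the image of B. *)
Definition unstraighten v : 'rV[R]_d := xget u0 [set u | B u /\ straighten u = v].

Let C := straighten @` B.

Let unstraightenP v : C v -> B (unstraighten v) /\ straighten (unstraighten v) = v.
Proof. 
move=> [u Bu <-].
exact: (@xgetPex _ u0 [set w | B w /\ straighten w = straighten u]
  (ex_intro _ u (conj Bu erefl))).
Qed.

Let straightenK u : B u -> unstraighten (straighten u) = u.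
Proof.
move=> Bu; have [|] := unstraightenP (v := straighten u); first by exists u.
by move=> ? ?; exact: straighten_inj.
Qed.

Let C_open : open C.
Proof.
rewrite openE => _ [u Bu <-]; apply/(nbhs0P C).
apply: filterS (straighten_local Bu ltr01) => h [s [_ Bs _ E]].
by exists (u + h + s *: e).
Qed.

(** The inverse also moves points only along e, so all its regularity is carried by this one scalar
    function. *)
Let shift_j v : R := unstraighten v 0 j - v 0 j.

Let unstraightenE v : C v -> unstraighten v = v + shift_j v *: e.
Proof.
move=> /unstraightenP[_]; rewrite /shift_j; set w := unstraighten v => E.
have -> : v 0 j = F w by rewrite -E straighten_coord.
by rewrite -[X in X + _]E /straighten -addrA -scalerDl addrA subrK subrr scale0r addr0.
Qed.

(** Solves the linearised equation for the displacement s: sum_k h_k partial_k F + s partial_j F =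
    h_j. *)
Let slope u : 'cV[R]_d := \col_k (((k == j)%:R - partial k F u) / partial j F u).

Let row_pair_slope u h : B u ->
  row_pair (slope u) h * partial j F u = h 0 j - \sum_k h 0 k * partial k F u.
Proof.
move=> Bu; have p0 : partial j F u != 0 by rewrite gt_eqF // Fj.
rewrite /row_pair mxE mulr_suml (bigD1 j) //= mxE eqxx mulrA mulfVK // mulrBr mulr1.
rewrite [in RHS](bigD1 j) //= opprD addrA; congr (_ + _).
rewrite -sumrN; apply: eq_bigr => k /negbTE kj.
by rewrite mxE kj mulrA mulfVK // sub0r mulrN.
Qed.

Let row_pair_le (a : 'cV[R]_d) h : `|row_pair a h| <= (\sum_k `|a k 0|) * `|h|.
Proof.
rewrite /row_pair mxE mulr_suml; apply: (le_trans (ler_norm_sum _ _ _)).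
apply: ler_sum => k _; rewrite normrM mulrC ler_wpM2l //.
exact: row_coord_le_norm.
Qed.

Let shift_j_diff u : B u ->
  is_diff (straighten u) shift_j (row_pair (slope u)).
Proof.
move=> Bu; apply: is_diff_near_row_pair => ep ep0.
set p := partial j F u; have p0 : 0 < p by exact: Fj.
pose L := \sum_k `|slope u k 0|; have L0 : 0 <= L by exact: sumr_ge0.
(* Let q be the distance from s to its linear prediction; then q p <= eta (|h| + |s|). The bound eta
   <= p / 2, with |s| <= q + L |h|, gives |h| + |s| <= (2 L + 2) |h|; the other bound on eta then
   gives q <= ep |h|. *)
pose eta : R := Num.min (p / 2) (ep * p / (2 * L + 2)).
have L20 : 0 < 2 * L + 2 by lra.
have eta0 : 0 < eta by rewrite lt_min divr_gt0 //= divr_gt0 // mulr_gt0.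
have eta1 : eta <= p / 2 by rewrite ge_min lexx.
have eta2 : eta * (2 * L + 2) <= ep * p by rewrite -ler_pdivlMr // ge_min lexx orbT.
have /nbhs_ballP[rho /= rho0 Hrho] := near_diff_partial (dF Bu) eta0.
(* With |h| < rho / 2 and |s| <= rho / 4, the displacement h + s e stays in the ball where the first
   order estimate of F holds. *)
have rho2 : 0 < rho / 2 by rewrite divr_gt0.
have hsmall : nbhs (0 : 'rV[R]_d) [set h | `|h| < rho / 2].
  apply/nbhs_ballP; exists (rho / 2) => // h.
  by rewrite -ball_normE /= sub0r normrN.
have rho4 : 0 < rho / 4 by rewrite divr_gt0.
apply: filterS2 hsmall (straighten_local Bu rho4) => h /= hs [s [ss Bs Fs E]].
have -> : shift_j (h + straighten u) - shift_j (straighten u) = s.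
  rewrite /shift_j [h + _]addrC -{1}E !straightenK //.
  by rewrite [(_ + h) 0 j]mxE straighten_coord !mxE !eqxx mulr1; ring.
have en : `|e| <= 1.
  rewrite [leLHS]/Num.Def.normr/= mx_normrE; apply: bigmax_le => // -[a b] _ /=.
  by rewrite mxE; case: (_ && _); rewrite ?normr1 ?normr0.
have zn : `|h + s *: e| <= `|h| + `|s|.
  apply: (le_trans (ler_normD _ _)); rewrite lerD2l normrZ.
  by rewrite -[leRHS]mulr1 ler_wpM2l.
have zB : ball 0 rho (h + s *: e).
  rewrite -ball_normE /= sub0r normrN.
  by apply: (le_lt_trans zn); lra.
have {Hrho} := Hrho _ zB; rewrite /= [_ + u]addrC addrA Fs.
have -> : \sum_k (h + s *: e) 0 k * partial k F u
    = \sum_k h 0 k * partial k F u + s * p.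
  rewrite [in RHS](bigD1 j) //= (bigD1 j) //= !mxE !eqxx mulr1 mulrDl -!addrA.
  congr (_ + _); rewrite addrC; congr (_ + _); apply: eq_bigr => k /negbTE kj.
  by rewrite !mxE kj andbF mulr0 addr0.
have -> : F u + h 0 j - F u - (\sum_k h 0 k * partial k F u + s * p)
  = (row_pair (slope u) h - s) * p.
  by rewrite mulrBl row_pair_slope // -/p; ring.
rewrite normrM (gtr0_norm p0) distrC; set q := `|s - _| => qe.
have l1 : `|row_pair (slope u) h| <= L * `|h| by exact: row_pair_le.
have qs : `|s| <= q + L * `|h|.
  rewrite -[X in `|X|](subrK (row_pair (slope u) h)).
  by apply: (le_trans (ler_normD _ _)); rewrite lerD2l.
have q0 : 0 <= q by exact: normr_ge0.
have h0 : 0 <= `|h| by exact: normr_ge0.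
have s0 : 0 <= `|s| by exact: normr_ge0.
have qe2 : q * p <= eta * (`|h| + `|s|).
  by apply: (le_trans qe); rewrite ler_wpM2l // ltW.
have q1 : q <= (`|h| + `|s|) / 2.
  rewrite -(ler_pM2r p0); apply: (le_trans qe2).
  by rewrite mulrC -[leRHS]mulrA [_^-1 * _]mulrC ler_wpM2l // addr_ge0.
have sK : `|h| + `|s| <= (2 * L + 2) * `|h| by lra.
rewrite -(ler_pM2r p0); apply: (le_trans qe2).
apply: (@le_trans _ _ (eta * ((2 * L + 2) * `|h|))).
  by rewrite ler_wpM2l // ltW.
by rewrite mulrA [leRHS]mulrAC ler_wpM2r.
Qed.

Let shift_j_partial v i : C v -> partial i shift_j v =
  ((i == j)%:R - partial i F (unstraighten v)) * (partial j F (unstraighten v))^-1.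
Proof.
move=> /unstraightenP[Bu {1}<-]; rewrite (partial_row_pair _ (shift_j_diff Bu)).
by rewrite mxE.
Qed.

Let unstraighten_Ck n k : Ck n C shift_j -> Ck n C (fun v => unstraighten v 0 k).
Proof.
move=> Cs; apply: (@Ck_eq _ _ _ _ _ ((fun v => v 0 k) + (fun v => shift_j v * cst (e 0 k) v))) => //.
  by move=> v Cv; rewrite unstraightenE // !mxE.
apply: CkD => //; first exact: Ck_coord.
by apply: CkM => //; exact: Ck_cst.
Qed.

(** Bootstrap: the partial derivatives of [shift_j] are quotients of derivatives of F evaluated at
    [unstraighten], which is as regular as [shift_j] itself, so one order is gained at each turn. *)
Let shift_j_smooth n : Ck n C shift_j.
Proof.
have D v : C v -> differentiable shift_j v.
  by move=> /unstraightenP[/shift_j_diff[D _]] E; rewrite E in D.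
elim: n => [|n IH]; split=> // i.
have F_Ck k : Ck n C (partial k F \o unstraighten).
  apply: (@Ck_comp _ _ _ _ B) => //.
  - by move=> v /unstraightenP[].
  - by move=> l; exact: unstraighten_Ck.
  - exact: ((smooth_onP _ _).1 (smooth_on_partial _ FB)).
apply: (@Ck_eq _ _ _ _ _ (fun v => ((cst (i == j)%:R + (fun v => - (partial i F \o unstraighten) v)) v)
    * ((partial j F \o unstraighten) v)^-1)) => //.
  by move=> v Cv; rewrite shift_j_partial.
apply: CkM => //.
  by apply: CkD => //; [exact: Ck_cst | exact: CkN].
apply: CkV => // v /unstraightenP[Bv _] /=.
by rewrite gt_eqF // Fj.
Qed.

Lemma straightening : exists (C : set 'rV[R]_d) (Psi : 'rV[R]_d -> 'rV[R]_d),
  [/\ open C, forall u, ball u0 r u -> C (straighten u) /\ Psi (straighten u) = u,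
      forall v, C v -> ball u0 r (Psi v) /\ straighten (Psi v) = v &
      forall k, smooth_on C (fun v => Psi v 0 k)].
Proof.
exists C, unstraighten; split=> //.
- by move=> u Bu; split; [exists u | exact: straightenK].
- by move=> k; apply/smooth_onP => n; exact: unstraighten_Ck.
Qed.

Lemma straighten_smooth k : smooth_on B (fun u => straighten u 0 k).
Proof.
have oB : open B by exact: ball_open.
apply: (@smooth_on_eq _ _ _ _ (if k == j then F else fun u => u 0 k)) => //.
  move=> u Bu; rewrite !mxE eqxx /=; case: eqVneq => [->|]; last by rewrite mulr0 addr0.
  by rewrite mulr1 addrC subrK.
by case: eqVneq => // _; exact: smooth_on_coord.
Qed.

End Straightening.

(** * Charts *)

(* Imported again so that [point] is the field of [chart] and not
   [Pointed.point]. *)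
Import Pilot.Defs.

Lemma open_preimage_in (S T : topologicalType) (A : set S) (g : S -> T) (V : set T) :
  open A -> (forall u, A u -> {for u, continuous g}) -> open V ->
  open [set u | A u /\ V (g u)].
Proof.
move=> oA cg oV; rewrite openE => u [Au Vu]; apply: filterI.
  exact: open_nbhs_nbhs.
by apply: (cg _ Au); exact: open_nbhs_nbhs.
Qed.

Section Charts.
Variables (R : realType) (d : nat) (M : manifold R d).
Implicit Types (phi psi : chart R d M) (x y : M) (V : set M) (f : M -> R).

Lemma open_chart_preimage phi V : open V -> open [set u | cod phi u /\ V (point phi u)].
Proof.
apply: open_preimage_in; [exact: cod_open | exact: point_continuous].
Qed.

Lemma near_coord phi V x : dom phi x -> open V -> V x ->
  \forall u \near coord phi x, cod phi u /\ V (point phi u).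
Proof.
move=> dx oV Vx; apply: open_nbhs_nbhs; split; first exact: open_chart_preimage.
by split; [exact: coord_cod | rewrite coordK].
Qed.

Definition diff_at phi f x := differentiable (fun u => f (point phi u)) (coord phi x).

Lemma smooth_in_diff_at V phi f x : smooth_in V phi f -> dom phi x -> V x ->
  diff_at phi f x.
Proof.
by move=> H dx Vx; apply: (H [::]); split; [exact: coord_cod | rewrite coordK].
Qed.

Lemma transition_diff phi psi x k : atlas phi -> atlas psi -> dom phi x -> dom psi x ->
  diff_at phi (fun y => coord psi y 0 k) x.
Proof.
move=> ap aq dx ex; have [H _] := atlas_compatible ap aq.
by apply: (H k [::]); split; [exact: coord_cod | rewrite coordK].
Qed.

(** The two readings of a function agree only on the overlap of the charts; agreement near the point
    is what derivatives there require. *)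
Lemma near_transition phi psi f x : dom phi x -> dom psi x ->
  \forall u \near coord phi x,
    f (point phi u) = f (point psi (coord psi (point phi u))).
Proof.
move=> dx ex; apply: filterS (near_coord dx (dom_open psi) ex) => u [_ eu].
by rewrite coordK.
Qed.

Lemma diff_at_change phi psi f x : atlas phi -> atlas psi -> dom phi x -> dom psi x ->
  diff_at psi f x -> diff_at phi f x.
Proof.
move=> ap aq dx ex df; apply: near_eq_differentiable (near_transition f dx ex) _.
apply: (differentiable_comp (f := fun u => coord psi (point phi u))
  (g := fun u => f (point psi u))); last by rewrite coordK.
by apply: differentiable_row => k; exact: transition_diff.
Qed.

Lemma pd_change phi psi f x i : atlas phi -> atlas psi -> dom phi x -> dom psi x ->
  diff_at psi f x -> pd phi i f x = \sum_k jac phi psi x i k * pd psi k f x.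
Proof.
move=> ap aq dx ex df; rewrite /pd {1}/partial (near_eq_derive _ (near_transition f dx ex)).
have := @partial_comp _ _ (fun u => f (point psi u)) (fun u => coord psi (point phi u)) i (coord phi x).
rewrite /partial /= coordK // => -> //; last by move=> k; exact: transition_diff.
by apply: eq_bigr => k _; rewrite mxE.
Qed.

Lemma diff_fun_change phi psi f x : atlas phi -> atlas psi -> dom phi x -> dom psi x ->
  diff_at psi f x -> diff_fun f phi x = diff_fun f psi x *m (jac phi psi x)^T.
Proof.
move=> ap aq dx ex df; apply/rowP => i; rewrite !mxE (pd_change i ap aq dx ex df).
by apply: eq_bigr => k _; rewrite !mxE mulrC.
Qed.

Lemma pdB phi f f' x i : diff_at phi f x -> diff_at phi f' x ->
  pd phi i (fun y => f y - f' y) x = pd phi i f x - pd phi i f' x.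
Proof. by move=> df df'; apply: deriveB; exact: diff_derivable. Qed.

Lemma pdM phi f f' x i : diff_at phi f x -> diff_at phi f' x -> dom phi x ->
  pd phi i (fun y => f y * f' y) x = f x * pd phi i f' x + f' x * pd phi i f x.
Proof.
move=> df df' dx.
have := deriveM (diff_derivable (v := 'e_i) df) (diff_derivable (v := 'e_i) df').
by rewrite coordK.
Qed.

Lemma pd_diff_at V phi f x i : open V -> smooth_in V phi f -> dom phi x -> V x ->
  diff_at phi (pd phi i f) x.
Proof.
move=> oV sf dx Vx.
apply: (@near_eq_differentiable _ _ _ _ (partial i (fun u => f (point phi u)))).
  apply: filterS (near_coord dx oV Vx) => u [cu _].
  by rewrite /pd pointK.
apply: (smooth_on_partial i sf [::]).
by split; [exact: coord_cod | rewrite coordK].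
Qed.

Lemma rescaling_id (g : cotensor2 M) : rescaling g (fun=> 1) g.
Proof.
split=> // [phi _|phi x _ _]; last by rewrite expr1n scale1r.
by apply/smooth_onP => n; exact: Ck_cst.
Qed.

(** The new chart is phi, restricted to the preimage of a small ball, followed by the straightening
    of f read in phi. *)
Lemma adapted_chart phi f x j : atlas phi -> smooth_in setT phi f -> dom phi x ->
  0 < pd phi j f x ->
  exists psi, [/\ atlas psi, dom psi x & forall y, dom psi y -> coord psi y 0 j = f y].
Proof.
move=> ap sf dx pf; pose F u := f (point phi u).
pose W := [set u | cod phi u /\ setT (point phi u)].
have oW : open W by apply: open_chart_preimage; exact: openT.
have sF : smooth_on W F by [].
have Wx : W (coord phi x) by split=> //; exact: coord_cod.
have [r r0 Hr] : exists2 r, 0 < r & forall u, ball (coord phi x) r u -> W u /\ 0 < partial j F u.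
  have cF := smooth_on_continuous (smooth_on_partial j sF) Wx.
  have N : \forall u \near coord phi x, W u /\ 0 < partial j F u.
    apply: filterI; first exact: open_nbhs_nbhs.
    by apply: (cF [set t | 0 < t]); exact: lt_nbhsr.
  by have /nbhs_ballP[r r0 H] := N; exists r.
set u0 := coord phi x in Wx Hr.
have FB : smooth_on (ball u0 r) F by apply: smooth_on_sub sF => u /Hr[].
have Fj u : ball u0 r u -> 0 < partial j F u by move=> /Hr[].
have [C [Psi [oC BC CB sPsi]]] := straightening r0 FB Fj.
have sPhi := straighten_smooth j FB : forall k, smooth_on _ (fun u => straighten F j u 0 k).
have oB : open (ball u0 r) by exact: ball_open.
have row_cont (A : set 'rV[R]_d) (G : 'rV[R]_d -> 'rV[R]_d) u :
    (forall k, smooth_on A (fun u => G u 0 k)) -> A u -> {for u, continuous G}.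
  move=> sG Au; apply: differentiable_continuous; apply: differentiable_row => k.
  exact: (sG k [::]).
have Bcod u : ball u0 r u -> cod phi u by move=> /Hr[[]].
pose D := [set y | dom phi y /\ ball u0 r (coord phi y)].
have oD : open D.
  by apply: open_preimage_in => //; [exact: dom_open | exact: coord_continuous].
have coord_C y : D y -> C (straighten F j (coord phi y)) by move=> [_ /BC[]].
have point_D v : C v -> D (point phi (Psi v)).
  move=> /CB[Bv _]; split; first by apply: point_dom; exact: Bcod.
  by rewrite pointK //; exact: Bcod.
have coordK' y : D y -> point phi (Psi (straighten F j (coord phi y))) = y.
  by move=> [dy /BC[_ ->]]; exact: coordK.
have pointK' v : C v -> straighten F j (coord phi (point phi (Psi v))) = v.
  by move=> /CB[Bv {2}<-]; rewrite pointK //; exact: Bcod.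
have coord_cont y : D y -> {for y, continuous (fun y => straighten F j (coord phi y))}.
  move=> [dy By]; apply: (continuous_comp (coord_continuous dy)).
  exact: row_cont sPhi By.
have point_cont v : C v -> {for v, continuous (fun v => point phi (Psi v))}.
  move=> Cv; apply: (continuous_comp (row_cont _ _ _ sPsi Cv)).
  by apply: point_continuous; apply: Bcod; case: (CB _ Cv).
pose psi := Chart oD oC coord_C point_D coordK' pointK' coord_cont point_cont.
exists psi; split.
(* By maximality it is enough to check transitions with each chart chi of the atlas; these factor
   through phi, as [Psi] followed by the transition from phi to chi, or as the transition from chi
   to phi followed by [straighten]. *)
- apply: atlas_maximal => chi ac; have [T1 T2] := atlas_compatible ap ac.
  split=> k /=.
    apply: (@smooth_on_comp _ _ _ _ (fun u => coord chi (point phi u) 0 k) Psi _ _ _ (T1 k)) => //.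
    + by apply: open_preimage_in => //; exact: dom_open.
    + by move=> v [Cv dv]; split=> //; apply: Bcod; case: (CB _ Cv).
    + by move=> l; apply: smooth_on_sub (sPsi l) => v [].
  apply: (@smooth_on_comp _ _ _ _ (fun u => straighten F j u 0 k)
    (fun u => coord phi (point chi u)) _ _ _ (sPhi k)) => //.
  + exact: open_chart_preimage oD.
  + by move=> v [_ []].
  + by move=> l; apply: smooth_on_sub (T2 l) => v [cv [dv _]].
- split=> //; exact: ballxx.
- by move=> y [dy By] /=; rewrite straighten_coord /F coordK.
Qed.

End Charts.

(** * Hypersurfaces *)

Section HypersurfaceAlgebra.
Variables (R : realType) (d : nat) (eps : R) (N : 'rV[R]_d) (G : 'M[R]_d).
Hypothesis GU : G \in unitmx.
Hypothesis eps2 : eps * eps = 1.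
Hypothesis NN : gpair G N N = eps.

Let NGN : N *m invmx G *m N^T = eps%:M.
Proof. by rewrite [LHS]mx11_scalar -NN. Qed.

(** The product [inv *m ind] is the identity minus a rank one projection, so its trace is d - 1, the
    divisor in [trace_free_part]. *)
Lemma trace_free_part_induced (lam : R) : d != 1%N ->
  trace_free_part eps N G (lam *: (G - eps *: (N^T *m N))) = 0.
Proof.
move=> d1; rewrite /trace_free_part -scalemxAr mxtraceZ.
set ind := G - _; set inv := invmx G - _.
have Nind : N *m invmx G *m ind = 0.
  rewrite /ind mulmxBr mulmxKV // -scalemxAr mulmxA NGN mul_scalar_mx scalerA.
  by rewrite eps2 scale1r subrr.
have -> : inv *m ind = 1%:M - eps *: (invmx G *m N^T *m N).
  rewrite /inv mulmxBl -scalemxAl -[_ *m ind in X in _ - X]mulmxA Nind mulmx0 scaler0 subr0.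
  by rewrite /ind mulmxBr mulVmx // -scalemxAr mulmxA.
have -> : \tr (1%:M - eps *: (invmx G *m N^T *m N)) = d%:R - 1.
  rewrite -scaleNr mxtraceD mxtraceZ mxtrace1 mxtrace_mulC mulmxA NGN.
  by rewrite mxtrace_scalar mulr1n mulNr eps2.
by rewrite mulfK ?subrr // subr_eq0 (eqr_nat R _ 1).
Qed.

(** Terms with first factor N are killed since eps g(N, N) = 1. Hence the derivative of a conormal
    need be known only modulo such terms, with w arbitrary. *)
Lemma tangential_projection (lam : R) (w : 'rV[R]_d) :
  let A := lam *: G + N^T *m w in
  A - eps *: (N^T *m (N *m invmx G *m A)) = lam *: (G - eps *: (N^T *m N)).
Proof.
rewrite /= mulmxDr -scalemxAr mulmxKV // mulmxA NGN mul_scalar_mx mulmxDr.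
rewrite -!scalemxAr !scalerDr !scalerA eps2 scale1r scalerN scalerA opprD.
by rewrite addrACA subrr addr0 mulrC.
Qed.

End HypersurfaceAlgebra.

(** Cramer's rule: the diagonal entry j of the inverse is the complementary minor divided by the
    determinant. *)
Lemma row'_col'_unitmx (F : fieldType) (d : nat) (G : 'M[F]_d) (j : 'I_d) :
  G \in unitmx -> invmx G j j != 0 -> row' j (col' j G) \in unitmx.
Proof.
move=> GU; rewrite /invmx GU !mxE mulf_eq0 negb_or => /andP[_].
by rewrite /cofactor mulf_eq0 negb_or unitmxE unitfE => /andP[].
Qed.

(** * Derivatives of functions that vanish on a hypersurface *)

Section Slices.
Variables (R : realType) (d : nat) (M : manifold R d) (S : set M).
Implicit Types (phi psi : chart R d M) (x y : M) (V : set M) (f s : M -> R).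

(** The i-th coordinate line through x keeps the j-th coordinate zero, so near x it runs inside S
    and V and the difference quotients of f vanish. *)
Lemma pd_slice psi j x V f i : slice_chart S psi j -> dom psi x -> S x ->
  open V -> V x -> (forall y, S y -> V y -> f y = 0) -> i != j ->
  pd psi i f x = 0.
Proof.
move=> [ap sl] dx Sx oV Vx f0 ij.
rewrite /pd /partial /derive; apply: cvg_lim => //.
apply: cvg_near_cst.
have C : (fun h : R => h *: ('e_i : 'rV[R]_d) + coord psi x) @ 0 --> coord psi x.
  have := cvgD (@scalel_continuous R 'rV[R]_d 'e_i 0) (cvg_cst (coord psi x)).
  by rewrite scale0r add0r; apply; exact: nbhs_filter.
pose U := [set u | cod psi u /\ V (point psi u)].
have N : \forall h \near (0 : R)^', U (h *: 'e_i + coord psi x).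
  apply: nbhs_dnbhs; exact: (C _ (near_coord dx oV Vx)).
apply: filterS N => h [cu Vh].
have E0 u : cod psi u -> u 0 j = 0 -> V (point psi u) -> f (point psi u) = 0.
  move=> cu' uj Vu; apply: f0 => //; apply/sl; first exact: point_dom.
  by rewrite pointK.
rewrite /= !E0 ?subrr ?scaler0 //.
- exact: coord_cod.
- exact/sl.
- by rewrite coordK.
- by rewrite !mxE eqxx /= eq_sym (negbTE ij) mulr0 add0r; exact/sl.
Qed.

(** Lagrange multipliers: in a slice chart both differentials have only their j-th component, and
    the Jacobian carries this proportionality to phi. *)
Lemma pd_tangential phi x V f s : hypersurface S -> atlas phi -> dom phi x -> S x ->
  open V -> V x -> (forall y, S y -> V y -> f y = 0) -> (forall y, S y -> s y = 0) ->
  diff_at phi f x -> diff_at phi s x -> diff_fun s phi x != 0 ->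
  exists lam, forall i, pd phi i f x = lam * pd phi i s x.
Proof.
move=> hS ap dx Sx oV Vx f0 s0 df ds ds0.
have [psi [j [sl ex]]] := hS x Sx; have [aq _] := sl.
have E g V' : open V' -> V' x -> (forall y, S y -> V' y -> g y = 0) -> diff_at phi g x ->
    forall i, pd phi i g x = jac phi psi x i j * pd psi j g x.
  move=> oV' V'x g0 dg i.
  have dg' := diff_at_change aq ap ex dx dg.
  rewrite (pd_change i ap aq dx ex dg') (bigD1 j) //= big1 ?addr0 // => k kj.
  by rewrite (pd_slice sl ex Sx oV' V'x g0 kj) mulr0.
have Es := E s setT openT I (fun y Sy _ => s0 y Sy) ds.
have Ef := E f V oV Vx f0 df.
have sj : pd psi j s x != 0.
  apply: contra ds0 => /eqP sj; apply/eqP/rowP => i.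
  by rewrite !mxE Es sj mulr0.
exists (pd psi j f x / pd psi j s x) => i.
by rewrite Ef Es [RHS]mulrC -mulrA [_ * (_ / _)]mulrC divfK.
Qed.

End Slices.

(** * The scale singularity set *)

Section ConformalClass.
Variables (R : realType) (d : nat) (M : manifold R d) (p : nat).
Variable c : set (cotensor2 M).
Hypothesis hc : conformal_class p c.

Lemma conformal_class_unitmx g phi (x : M) : c g -> atlas phi -> dom phi x ->
  g phi x \in unitmx.
Proof.
case: hc => g0 [_ nd] -> [Om [_ Om0 E]] ap dx; rewrite E //.
have [P PU H] := nd phi x ap dx.
rewrite unitmxZ; last by rewrite unitfE expf_neq0 // gt_eqF.
have : P *m g0 phi x *m P^T \in unitmx.
  rewrite H unitmxE det_diag unitfE; apply/prodf_neq0 => i _.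
  by rewrite mxE; case: ifP; rewrite ?oppr_eq0 oner_eq0.
by rewrite !unitmx_mul => /andP[/andP[]].
Qed.

Lemma zero_locusE (sigma : cotensor2 M -> M -> R) g x : density c 1 sigma -> c g ->
  zero_locus c sigma x <-> sigma g x = 0.
Proof.
move=> [_ resc] cg; split=> [|sg gh cgh]; first exact.
(* Membership in the class only relates a metric to the base metric g0, so g and gh are compared
   through g0. *)
case: hc => g0 mg0 cE; have cg0 : c g0 by rewrite cE; exists (fun=> 1); exact: rescaling_id.
move: (cg) (cgh); rewrite {1 2}cE => -[Om HOm] [Om' HOm'].
have := resc _ _ _ cg0 cg HOm x; rewrite sg expr1z => /esym/eqP.
have [_ Om0 _] := HOm.
rewrite mulf_eq0 gt_eqF //= => /eqP s0.
by rewrite (resc _ _ _ cg0 cgh HOm' x) s0 mulr0.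
Qed.

End ConformalClass.

Section AsymptoticallyEinstein.
Variables (R : realType) (d : nat) (M : manifold R d) (p : nat).
Variables (c : set (cotensor2 M)) (sigma : cotensor2 M -> M -> R) (eps : R).
Variable f : cotensor2 M -> chart R d M -> M -> 'I_d -> tractor R d.
Hypothesis hd : (3 <= d)%N.
Hypothesis hc : conformal_class p c.
Hypothesis hsigma : density c 1 sigma.
Hypothesis heps : eps = 1 \/ eps = -1.
Let S := zero_locus c sigma.
Hypothesis hI2 : forall g phi x, c g -> atlas phi -> dom phi x -> S x ->
  tractor_norm (g phi x) (scale_tractor sigma g phi x) = eps.
Hypothesis hnabla : forall g phi x a, c g -> atlas phi -> dom phi x ->
  tractor_connection g (scale_tractor sigma g) phi x a =
    tscale (sigma g x) (f g phi x a).
Implicit Types (g : cotensor2 M) (phi psi : chart R d M) (x y : M).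

Let eps2 : eps * eps = 1.
Proof. by case: heps => ->; rewrite ?mulrNN mulr1. Qed.

Let eps0 : eps != 0.
Proof. by apply/eqP => e0; move: eps2; rewrite e0 mul0r => /esym/eqP; rewrite oner_eq0. Qed.

Let S0 g x : c g -> S x -> sigma g x = 0.
Proof. by move=> cg; rewrite /S (zero_locusE hc _ hsigma cg). Qed.

Let sigma_smooth g phi : c g -> atlas phi -> smooth_in setT phi (sigma g).
Proof. by move=> cg; case: hsigma => + _; move=> /(_ g cg); exact. Qed.

Let sigma_diff g phi x : c g -> atlas phi -> dom phi x -> diff_at phi (sigma g) x.
Proof. by move=> cg ap dx; exact: smooth_in_diff_at (sigma_smooth cg ap) dx I. Qed.

Lemma gpair_scale_differential g phi x : c g -> atlas phi -> dom phi x -> S x ->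
  gpair (g phi x) (diff_fun (sigma g) phi x) (diff_fun (sigma g) phi x) = eps.
Proof.
move=> cg ap dx Sx; rewrite -(hI2 cg ap dx Sx) /tractor_norm /=.
by rewrite (S0 cg Sx) mulr0 mul0r add0r.
Qed.

Lemma scale_differential_neq0 g phi x : c g -> atlas phi -> dom phi x -> S x ->
  diff_fun (sigma g) phi x != 0.
Proof.
move=> cg ap dx Sx; apply: contra eps0 => /eqP D0.
by rewrite -(gpair_scale_differential cg ap dx Sx) D0 /gpair !mul0mx mxE.
Qed.

Lemma hessian_scale g phi x : c g -> atlas phi -> dom phi x -> S x ->
  exists rho, cov_deriv g phi (diff_fun (sigma g)) x = rho *: g phi x.
Proof.
(* On S both sigma f and the Schouten term vanish, leaving Hess sigma + rho g = 0 with rho the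
   bottom slot of I. *)
move=> cg ap dx Sx; exists (- trho (scale_tractor sigma g phi x)).
apply/matrixP => a b.
have /(congr1 (fun t => tmu t 0 b)) := hnabla a cg ap dx.
rewrite /tractor_connection /tscale /= [LHS]mxE (S0 cg Sx) scale0r !mulr0 !addr0.
rewrite mxE [RHS]mxE mulrC => /eqP; rewrite addr_eq0 => /eqP ->.
by rewrite mxE !mulNr.
Qed.

Lemma zero_locus_hypersurface : hypersurface S.
Proof.
move=> x Sx; have [g cg] : exists g, c g.
  by case: hc => g0 _ ->; exists g0; exists (fun=> 1); exact: rescaling_id.
have [phi ap dx] := atlas_cover x.
have /rV0Pn[j] := scale_differential_neq0 cg ap dx Sx; rewrite mxE => pj.
have S_sigma y : S y <-> sigma g y = 0 by exact: (zero_locusE hc y hsigma cg).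
(* [adapted_chart] wants a positive derivative, so the new coordinate is sigma or - sigma; both have
   the same zeros. *)
have [psi [aq ex E]] : exists psi, [/\ atlas psi, dom psi x &
    forall y, dom psi y -> coord psi y 0 j = 0 <-> sigma g y = 0].
  have [p0|p0|p0] := ltgtP (pd phi j (sigma g) x) 0; last by rewrite p0 eqxx in pj.
    have sN : smooth_in setT phi (fun y => - sigma g y).
      apply/smooth_onP => n; apply: CkN; first by apply: open_chart_preimage; exact: openT.
      by apply: (smooth_onP _ _).1; exact: sigma_smooth.
    have pN : 0 < pd phi j (fun y => - sigma g y) x.
      rewrite /pd /partial (deriveN (f := fun u => sigma g (point phi u))) ?oppr_gt0 //.
      by apply: diff_derivable; exact: sigma_diff.
    have [psi [aq ex E]] := adapted_chart ap sN dx pN.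
    exists psi; split=> // y dy; rewrite E //; split => [/eqP|->]; rewrite ?oppr0 //.
    by rewrite oppr_eq0 => /eqP.
  have [psi [aq ex E]] := adapted_chart ap (sigma_smooth cg ap) dx p0.
  by exists psi; split=> // y dy; rewrite E.
by exists psi, j; split=> //; split=> // y dy; rewrite S_sigma E.
Qed.

Let pd_slice_sigma g psi j x i : c g -> slice_chart S psi j -> dom psi x -> S x ->
  i != j -> pd psi i (sigma g) x = 0.
Proof.
move=> cg sl dx Sx; apply: (pd_slice sl dx Sx openT) => // y Sy _.
exact: S0.
Qed.

(** In a slice chart d sigma has only its j-th component, so eps is the square of that component
    times the entry (j, j) of the inverse metric, which is therefore nonzero. *)
Lemma zero_locus_nondegenerate : nondegenerate c S.
Proof.
move=> g psi j x cg sl dx Sx; have [aq _] := sl.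
have GU := conformal_class_unitmx hc cg aq dx.
apply: row'_col'_unitmx => //; apply: contra eps0 => /eqP G0.
rewrite -(gpair_scale_differential cg aq dx Sx).
have -> : diff_fun (sigma g) psi x = pd psi j (sigma g) x *: 'e_j.
  apply/rowP => i; rewrite !mxE eqxx /=; case: eqVneq => [->|ij]; first by rewrite mulr1.
  by rewrite mulr0 (pd_slice_sigma cg sl dx Sx ij).
rewrite /gpair -!scalemxAl linearZ /= -scalemxAr -rowE trmx_delta -colE.
by rewrite !mxE G0 !mulr0.
Qed.

(** * Unit conormals and umbilicity *)

Section Conormal.
Variables (V : set M) (eps' : R) (n : cotensor2 M -> covector M).
Hypothesis heps' : eps' = 1 \/ eps' = -1.
Hypothesis hn : unit_conormal c S V eps' n.

(* n is a multiple of d sigma along S; as eps and eps' are signs, equality of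
   squares forces the factor to be a sign and eps' = eps. *)
Let conormal_sign g phi x : c g -> atlas phi -> dom phi x -> S x -> V x ->
  exists2 nu, n g phi x = nu *: diff_fun (sigma g) phi x & eps' = eps /\ nu * nu = 1.
Proof.
move=> cg ap dx Sx Vx; have [oV [nf _] n0 nn] := hn.
have [psi [j [sl ex]]] := zero_locus_hypersurface Sx; have [aq _] := sl.
have [nsm nch] := nf g cg.
have sj : pd psi j (sigma g) x != 0.
  have /rV0Pn[i] := scale_differential_neq0 cg aq ex Sx; rewrite mxE.
  by case: (eqVneq i j) => [->|ij] //; rewrite (pd_slice_sigma cg sl ex Sx ij) eqxx.
(* Proportionality is read off in a slice chart, where only the j-th components survive, and carried
   to phi by the transformation law of covectors. *)
have [nu npsi] : exists nu, n g psi x = nu *: diff_fun (sigma g) psi x.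
  exists (n g psi x 0 j / pd psi j (sigma g) x); apply/rowP => i.
  rewrite !mxE; case: (eqVneq i j) => [->|ij]; first by rewrite divfK.
  by rewrite (pd_slice_sigma cg sl ex Sx ij) mulr0 (n0 g psi j x).
have nphi : n g phi x = nu *: diff_fun (sigma g) phi x.
  rewrite (nch phi psi x) // npsi -scalemxAl; congr (_ *: _).
  by rewrite -diff_fun_change //; exact: sigma_diff.
exists nu => //.
have : nu * nu * eps = eps'.
  rewrite -(nn g phi x cg ap dx Sx Vx) nphi -(gpair_scale_differential cg ap dx Sx).
  by rewrite /gpair -!scalemxAl linearZ /= -scalemxAr !mxE mulrA.
have : 0 <= nu * nu by exact: sqr_ge0.
by case: heps heps' => -> [] -> ? ?; split; lra.
Qed.

(* Along S one has n_a n_b = (d sigma)_a (d sigma)_b.  Differentiating this in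
   directions tangent to S gives nabla_v n = nu nabla_v (d sigma). *)
Let conormal_derivative g phi x nu : c g -> atlas phi -> dom phi x -> S x -> V x ->
  n g phi x = nu *: diff_fun (sigma g) phi x -> nu * nu = 1 ->
  exists w : 'rV[R]_d, cov_deriv g phi (n g) x =
    nu *: cov_deriv g phi (diff_fun (sigma g)) x + (diff_fun (sigma g) phi x)^T *m w.
Proof.
move=> cg ap dx Sx Vx nE nu2; have [oV [nf _] n0 nn] := hn.
have [nsm nch] := nf g cg.
set D := diff_fun (sigma g) phi x in nE *.
(* V is cut down to [dom phi] because [conormal_sign] compares components in phi only there. *)
have oW : open (V `&` dom phi) by apply: openI => //; exact: dom_open.
have dn b : diff_at phi (fun y => n g phi y 0 b) x.
  exact: smooth_in_diff_at (nsm phi ap b) dx Vx.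
have ds b : diff_at phi (pd phi b (sigma g)) x.
  exact: pd_diff_at openT (sigma_smooth cg ap) dx I.
have /rV0Pn[b0] := scale_differential_neq0 cg ap dx Sx; rewrite -/D => Db0.
have DE b : pd phi b (sigma g) x = D 0 b by rewrite mxE.
have nb b : n g phi x 0 b = nu * D 0 b by rewrite nE mxE.
clearbody D.
have dM (u v : M -> R) : diff_at phi u x -> diff_at phi v x ->
    diff_at phi (fun y => u y * v y) x.
  by move=> du dv; exact: differentiableM du dv.
(* The function n_b n_b0 - (d sigma)_b (d sigma)_b0 vanishes on S near x, so its differential at x
   is a multiple of D; b0 is fixed with D_b0 nonzero to allow division. *)
have lamP b : exists lam, forall a,
    n g phi x 0 b * pd phi a (fun y => n g phi y 0 b0) x
    + n g phi x 0 b0 * pd phi a (fun y => n g phi y 0 b) x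
    - (D 0 b * pd phi a (pd phi b0 (sigma g)) x + D 0 b0 * pd phi a (pd phi b (sigma g)) x)
    = lam * D 0 a.
  have [|||||lam H] := @pd_tangential _ _ _ S phi x (V `&` dom phi)
    (fun y => n g phi y 0 b * n g phi y 0 b0
              - pd phi b (sigma g) y * pd phi b0 (sigma g) y) (sigma g)
    zero_locus_hypersurface ap dx Sx oW (conj Vx dx).
  - move=> y Sy [Vy dy]; have [nu' E [_ nu'2]] := conormal_sign cg ap dy Sy Vy.
    by rewrite E !mxE mulrACA nu'2 mul1r subrr.
  - by move=> y; exact: S0.
  - exact: (differentiableB (dM _ _ (dn b) (dn b0)) (dM _ _ (ds b) (ds b0))).
  - exact: sigma_diff.
  - exact: scale_differential_neq0.
  exists lam => a; rewrite -[D 0 a]DE -H (pdB _ (dM _ _ (dn b) (dn b0)) (dM _ _ (ds b) (ds b0))).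
  by rewrite !pdM // !DE.
have [lam lamE] := choice lamP.
(* The case b = b0, divided by 2 D_b0, isolates the derivative of n_b0. *)
pose mu := lam b0 / (2 * D 0 b0).
have nu0 a : nu * pd phi a (fun y => n g phi y 0 b0) x - pd phi a (pd phi b0 (sigma g)) x
    = mu * D 0 a.
  have := lamE b0 a; rewrite !nb /mu => E.
  have D2 : 2 * D 0 b0 != 0 by rewrite mulf_neq0 // pnatr_eq0.
  apply: (mulfI D2); rewrite mulrA [2 * _ * (_ / _)]mulrC divfK // -E; ring.
(* Substituting the case b0 into the case b gives D_b0 (nu A - B) = (lam_b - D_b mu) D_a, with A and
   B the a-derivatives of n_b and (d sigma)_b; dividing by D_b0 and multiplying by nu, with nu^2 =
   1, yields this w. *)
exists (\row_b (nu * ((lam b - D 0 b * mu) / D 0 b0))).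
apply/matrixP => a b; rewrite !mxE big_ord1 !mxE.
set A := pd phi a (fun y => n g phi y 0 b) x.
have -> : pd phi a (fun y => diff_fun (sigma g) phi y 0 b) x = pd phi a (pd phi b (sigma g)) x.
  by congr (pd phi a _ x); apply/funext => y; rewrite mxE.
set B := pd phi a (pd phi b (sigma g)) x.
(* The Christoffel terms involve only values at x, where n = nu D. *)
have -> : \sum_k christoffel g phi k a b x * n g phi x 0 k
    = nu * \sum_k christoffel g phi k a b x * diff_fun (sigma g) phi x 0 k.
  by rewrite mulr_sumr; apply: eq_bigr => k _; rewrite nb mxE DE; ring.
have -> : A = nu * B + D 0 a * (nu * ((lam b - D 0 b * mu) / D 0 b0)).
  have E1 := lamE b a; have E2 := nu0 a; rewrite !nb -/A -/B in E1.
  have E3 : D 0 b0 * (nu * A - B) = (lam b - D 0 b * mu) * D 0 a.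
    rewrite mulrBl -[D 0 b * mu * _]mulrA -E2 -E1; ring.
  have -> : D 0 a * (nu * ((lam b - D 0 b * mu) / D 0 b0)) = nu * (nu * A - B).
    rewrite mulrCA; congr (_ * _); apply: (mulfI Db0); rewrite E3.
    by rewrite mulrCA [D 0 b0 * (_ / _)]mulrC divfK // mulrC.
  by rewrite mulrBr mulrA nu2 mul1r; ring.
by ring.
Qed.

Lemma zero_locus_umbilic g phi x : c g -> atlas phi -> dom phi x -> S x -> V x ->
  trace_free_part eps' (n g phi x) (g phi x)
    (second_fundamental_form eps' n g phi x) = 0.
Proof.
move=> cg ap dx Sx Vx; have [_ _ _ nn] := hn.
have [nu nE [-> nu2]] := conormal_sign cg ap dx Sx Vx.
have {}nn : gpair (g phi x) (n g phi x) (n g phi x) = eps.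
  rewrite (nn g phi x) //; by have [] := conormal_sign cg ap dx Sx Vx => ? _ [].
have GU := conformal_class_unitmx hc cg ap dx.
have [w E] := conormal_derivative cg ap dx Sx Vx nE nu2.
have [rho hess] := hessian_scale cg ap dx Sx.
(* As nu^2 = 1, d sigma = nu n at x, which turns the remainder into a term with first factor n. *)
have DN : cov_deriv g phi (n g) x = (nu * rho) *: g phi x + (n g phi x)^T *m (nu *: w).
  rewrite E hess scalerA; congr (_ + _).
  by rewrite nE -scalemxAr [(nu *: _)^T]linearZ -scalemxAl scalerA nu2 scale1r.
rewrite /second_fundamental_form DN tangential_projection //.
apply: trace_free_part_induced => //.
by rewrite neq_ltn (ltn_trans _ hd) ?orbT.
Qed.

End Conormal.

End AsymptoticallyEinstein.

Unset Implicit Arguments.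

Theorem corollary8p2 (R : realType) (d : nat) (hd : (3 <= d)%N)
    (M : manifold R d) (p : nat) (hp : (p <= d)%N)
    (c : set (cotensor2 M)) (hc : conformal_class p c)
    (sigma : cotensor2 M -> M -> R)
    (hsigma : almost_pseudo_Riemannian c sigma)
    (hSigma : zero_locus c sigma !=set0)
    (eps : R) (heps : eps = 1 \/ eps = -1)
    (hI2 : forall g phi x, c g -> atlas phi -> dom phi x ->
       zero_locus c sigma x ->
       tractor_norm (g phi x) (scale_tractor sigma g phi x) = eps)
    (f : cotensor2 M -> chart R d M -> M -> 'I_d -> tractor R d)
    (hf : tractor_form c (-1) f)
    (hnabla : forall g phi x a, c g -> atlas phi -> dom phi x ->
       tractor_connection g (scale_tractor sigma g) phi x a =
         tscale (sigma g x) (f g phi x a)) :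
  totally_umbilic_hypersurface c (zero_locus c sigma).
Proof.
have [dens _] := hsigma.
split.
- exact: zero_locus_hypersurface hc dens heps hI2.
- exact: zero_locus_nondegenerate hc dens heps hI2.
- move=> V eps' n heps' hn g phi x.
  exact: (zero_locus_umbilic hd hc dens heps hI2 hnabla heps' hn).
Qed.
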